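(* Let $p$ be a prime and let $R$ be a non-commutative ring with unity such that $|R|=p^5$ and $Z(R)$ is not a field. (a) Suppose that $Z(R)$ has $p^2$ elements. Then either $$\sigma_{\mathrm{snm}}(\Gamma_R)=\Big\{[-(p^3-p^2-1)^2]^{(p^2+p+1)(p^3-p^2-1)},\ [(p^3-p^2-1)^3]^{p^2+p+1}\Big\}$$ and $E_{\mathrm{sn}}(\Gamma_R)=2(p^2+p+1)(p^3-p^2-1)^3$; or $$\sigma_{\mathrm{snm}}(\Gamma_R)=\Big\{[-(p^3-p^2-1)^2]^{l_1(p^3-p^2-1)},\ [(p^3-p^2-1)^3]^{l_1},\ [-(p^4-p^2-1)^2]^{l_2(p^4-p^2-1)},\ [(p^4-p^2-1)^3]^{l_2}\Big\}$$ and $E_{\mathrm{sn}}(\Gamma_R)=2l_1(p^3-p^2-1)^3+2l_2(p^4-p^2-1)^3$, for some non-negative integers $l_1,l_2$ with $l_1+l_2(p+1)=p^2+p+1$. (b) Suppose that $Z(R)$ has $p^3$ elements. Then $$\sigma_{\mathrm{snm}}(\Gamma_R)=\Big\{[-(p^4-p^3-1)^2]^{(p+1)(p^4-p^3-1)},\ [(p^4-p^3-1)^3]^{p+1}\Big\}$$ and $E_{\mathrm{sn}}(\Gamma_R)=2(p+1)(p^4-p^3-1)^3$.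
   Context: For a ring $R$, $Z(R)$ is its center. For a finite non-commutative ring $R$, the commuting graph $\Gamma_R$ is the simple graph with vertex set $R\setminus Z(R)$ in which two distinct vertices are adjacent if they commute. Let $\Gamma$ be a finite simple graph with vertices $v_1,\dots,v_n$. Let $N(v_i)$ be the set of vertices adjacent to $v_i$, let $N^2(v_i)=\big(\bigcup_{u\in N(v_i)}N(u)\big)\setminus\{v_i\}$, and let $\delta_2(v_i)=\sum_{x\in N^2(v_i)}\deg x$. The minimum second neighborhood degree matrix $\mathrm{snm}(\Gamma)$ is the $n\times n$ matrix whose $(i,j)$ entry is $\min\{\delta_2(v_i),\delta_2(v_j)\}$ if $i\neq j$ and $v_i,v_j$ are adjacent, and $0$ otherwise. The MSN-spectrum $\sigma_{\mathrm{snm}}(\Gamma)$ is the multiset of eigenvalues of $\mathrm{snm}(\Gamma)$; $\{[\sigma_1]^{\alpha_1},\dots,[\sigma_k]^{\alpha_k}\}$ means eigenvalue $\sigma_i$ with multiplicity $\alpha_i$ (multiplicities of repeated values are added, entries with multiplicity $0$ are omitted). The MSN-energy is $E_{\mathrm{sn}}(\Gamma)=$ the sum of the absolute values of the eigenvalues of $\mathrm{snm}(\Gamma)$, counted with multiplicity. *)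

(* Defs.v *)
From HB Require Import structures.
From mathcomp Require Import all_boot all_order all_algebra all_field.

Set Implicit Arguments.
Unset Strict Implicit.
Unset Printing Implicit Defensive.

Import Order.TTheory GRing.Theory Num.Theory.
Local Open Scope ring_scope.

Record sgraph := SGraph {
  vertex :> finType;
  adj : rel vertex;
  adj_sym : symmetric adj;
  adj_irrefl : irreflexive adj }.

Section MinimumSecondNeighborhoodDegree.
Variable G : sgraph.

Definition nbhd (v : G) : {set G} := [set u | adj v u].

Definition deg (v : G) : nat := #|nbhd v|.

Definition nbhd2 (v : G) : {set G} := (\bigcup_(u in nbhd v) nbhd u) :\ v.

Definition delta2 (v : G) : nat := (\sum_(x in nbhd2 v) deg x)%N.

(* The vertices are numbered by enum_val; another numbering only conjugates
   the matrix by a permutation. *)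
Definition snm : 'M[algC]_#|G| :=
  \matrix_(i, j)
    if (i != j) && adj (enum_val i) (enum_val j)
    then (minn (delta2 (enum_val i)) (delta2 (enum_val j)))%:R else 0.

End MinimumSecondNeighborhoodDegree.

(* The roots of the characteristic polynomial, each repeated according to its
   multiplicity. The order of this list is arbitrary: compare with perm_eq. *)
Definition spectrum (n : nat) (A : 'M[algC]_n) : seq algC :=
  sval (closed_field_poly_normal (char_poly A)).

Definition msn_spectrum (G : sgraph) : seq algC := spectrum (snm G).

Definition msn_energy (G : sgraph) : algC := \sum_(x <- msn_spectrum G) `|x|.

Section CommutingGraph.
Variable R : finNzRingType.

Definition center : {set R} := [set z | [forall x, z * x == x * z]].

(* K is a field for the operations of R, with the unit 1 of R. *)
Definition is_field (K : {set R}) : Prop :=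
  [/\ subring_closed K,
      {in K &, commutative *%R} &
      {in K, forall x, x != 0 -> exists2 y, y \in K & x * y = 1}].

Definition noncentral : finType := {x : R | x \notin center}.

Definition commuting_adj : rel noncentral :=
  fun x y => (x != y) && (val x * val y == val y * val x).

Fact commuting_adj_sym : symmetric commuting_adj.
Proof.
by move=> x y; congr (_ && _); [rewrite eq_sym | exact: eq_sym].
Qed.

Fact commuting_adj_irrefl : irreflexive commuting_adj.
Proof. by move=> x; rewrite /commuting_adj eqxx. Qed.

Definition commuting_graph : sgraph :=
  SGraph commuting_adj_sym commuting_adj_irrefl.

End CommutingGraph.

(* Main.v *)
(* Z = Z(R) has at least p^2 elements, so a strict chain of additive subgroups
   of R above Z has at most three steps. Hence the centralizer C(x) of a
   non-central x is commutative, the sets C(x) \ Z partition the non-central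
   elements, and the commuting graph is a disjoint union of complete graphs.
   On a clique with m + 1 > 2 vertices snm is m^2 (J - I), which has the
   eigenvalues -m^2 (m times) and m^3 (once). The orders of the cliques are
   p^d - p^k with p^k = |Z| and k < d < 5, and counting the p^5 - p^k vertices
   gives the relation between l1 and l2. In (a) the first alternative is the
   case l2 = 0 of the second. *)
Require Import Defs.
From HB Require Import structures.
From mathcomp Require Import all_boot all_order all_algebra all_field all_fingroup.
From mathcomp Require Import ring zify.

Set Implicit Arguments.
Unset Strict Implicit.
Unset Printing Implicit Defensive.

Import Order.TTheory GRing.Theory Num.Theory.
Local Open Scope ring_scope.

(* A polynomial form of Sylvester's identity that avoids inverting [D]. *)
Lemma det_sub_mulmx (R : comNzRingType) n k (D : 'M[R]_n) (E : 'M[R]_k) U V :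
  D *m U = U *m E ->
  \det (D - U *m V) * \det E = \det D * \det (E - V *m U).
Proof.
(* Right multiplication of [M] by [1 0; -V 1] clears the block [V] and leaves D - U V. Right
   multiplication by [1 -U; 0 E] clears [U], because D U = U E, and leaves E - V U. *)
move=> DU; pose M := block_mx D U V 1%:M.
have <- : \det M = \det (D - U *m V).
  have <- : \det M * \det (block_mx 1%:M 0 (- V) 1%:M) = \det M.
    by rewrite det_lblock !det1 !mulr1.
  rewrite -det_mulmx mulmx_block.
  by rewrite !(mulmx0, mulmx1, mul1mx) !add0r mulmxN subrr det_ublock det1 mulr1.
have <- : \det (block_mx 1%:M (- U) 0 E) = \det E by rewrite det_ublock det1 mul1r.
rewrite -det_mulmx mulmx_block !(mulmx0, mulmx1, mul1mx) !addr0 !mulmxN DU.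
by rewrite addNr det_lblock addrC.
Qed.

(** * Characteristic polynomial for a disjoint union of complete graphs *)

Section DisjointCliques.

Variables (G : sgraph) (P : {set {set G}}).
Hypothesis P_part : partition P [set: G].
Hypothesis adjE : forall x y : G, adj x y = (x != y) && (y \in pblock P x).
Hypothesis clique_gt2 : {in P, forall K : {set G}, (2 < #|K|)%N}.

Let P_triv := partition_trivIset P_part.

Let mem_cover_P x : x \in cover P.
Proof. by rewrite (cover_partition P_part) inE. Qed.

Let mem_own x : x \in pblock P x.
Proof. by rewrite mem_pblock. Qed.

Let pblockP x : pblock P x \in P.
Proof. exact: pblock_mem. Qed.

Lemma clique_nbhd x : nbhd x = pblock P x :\ x.
Proof. by apply/setP=> y; rewrite !inE adjE eq_sym. Qed.

Lemma clique_deg x : deg x = #|pblock P x|.-1.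
Proof. by rewrite /deg clique_nbhd (cardsD1 x (pblock P x)) mem_own. Qed.

(** A vertex y of the clique of x is reached from x in two steps through a third vertex of the
    clique. This is where [clique_gt2] enters: in a clique with two vertices the second neighborhood
    is empty. *)
Lemma clique_nbhd2 x : nbhd2 x = pblock P x :\ x.
Proof.
apply/setP=> y; rewrite !inE; case: eqVneq => //= yNx.
apply/bigcupP/idP=> [[z] | xy].
  rewrite !clique_nbhd !inE => /andP[_ xz] /andP[_].
  by rewrite (same_pblock P_triv xz).
have /card_gt0P[z] : (0 < #|pblock P x :\ x :\ y|)%N.
  have := clique_gt2 (pblockP x).
  by rewrite (cardsD1 x) (cardsD1 y) mem_own !inE yNx xy.
rewrite !inE => /and3P[zNy zNx xz]; exists z; rewrite clique_nbhd !inE ?zNx //.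
by rewrite eq_sym zNy (same_pblock P_triv xz).
Qed.

Lemma clique_delta2 x : delta2 x = (#|pblock P x|.-1 ^ 2)%N.
Proof.
rewrite /delta2 clique_nbhd2 (eq_bigr (fun=> #|pblock P x|.-1)).
  by rewrite sum_nat_const -clique_nbhd -/(deg x) clique_deg.
move=> y; rewrite !inE => /andP[_ xy].
by rewrite clique_deg (same_pblock P_triv xy).
Qed.

Let vtx (i : 'I_#|G|) : G := enum_val i.
Let clq (c : 'I_#|P|) : {set G} := enum_val c.

Let inc : 'M[{poly algC}]_(#|G|, #|P|) :=
  \matrix_(i, c) (vtx i \in clq c)%:R.

Let wgt (K : {set G}) : {poly algC} := (#|K|.-1 ^ 2)%:R.

(** Up to the term m^2 I, the blocks m^2 J of [snm G] factor through the set of cliques as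
    [inc *m V]. So [det_sub_mulmx] trades the determinant indexed by vertices for a diagonal one
    indexed by cliques, and the factor [\det E] cancels at the end. *)
Lemma char_poly_cliques :
  char_poly (snm G) =
  \prod_(K in P) (('X + (#|K|.-1 ^ 2)%:R) ^+ #|K|.-1 * ('X - (#|K|.-1 ^ 3)%:R)).
Proof.
pose D : 'M[{poly algC}]_#|G| :=
  diag_mx (\row_i ('X + wgt (pblock P (vtx i)))).
pose E : 'M[{poly algC}]_#|P| := diag_mx (\row_c ('X + wgt (clq c))).
pose V : 'M[{poly algC}]_(#|P|, #|G|) :=
  \matrix_(c, i) (wgt (clq c) *+ (vtx i \in clq c)).
have blockE (x : G) (c : 'I_#|P|) : x \in clq c -> pblock P x = clq c.
  exact: (def_pblock P_triv (enum_valP c)).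
have DU : D *m inc = inc *m E.
  apply/matrixP=> i c; rewrite mul_diag_mx mul_mx_diag !mxE mulrC.
  have [/blockE-> // | _] := boolP (vtx i \in clq c).
  by rewrite mulr0n !mul0r.
have sum_block (x : G) (F : {set G} -> {poly algC}) :
    \sum_(c < #|P|) F (clq c) *+ (x \in clq c) = F (pblock P x).
  rewrite -(big_enum_val (fun K : {set G} => F K *+ (x \in K))).
  rewrite (bigD1 (pblock P x)) //= mem_own big1 ?addr0 // => K /andP[KP KNx].
  have [xK | //] := boolP (x \in K).
  by rewrite (def_pblock P_triv KP xK) eqxx in KNx.
have char_mxE : char_poly_mx (snm G) = D - inc *m V.
  apply/matrixP=> i j; rewrite !mxE.
  under eq_bigr do rewrite !mxE mulr_natl.
  rewrite (sum_block _ (fun K => wgt K *+ (vtx j \in K))).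
  rewrite adjE (inj_eq enum_val_inj) !clique_delta2 -/(vtx i) -/(vtx j).
  rewrite andbA andbb.
  have [-> | iNj] := eqVneq i j; first by rewrite mem_own subr0 mulr1n addrK.
  rewrite !mulr0n /=; have [ij | _] := boolP (vtx j \in _); last first.
    by rewrite mulr0n subrr.
  by rewrite (same_pblock P_triv ij) minnn polyC_natr.
have detE : \det E = \prod_(K in P) ('X + wgt K).
  rewrite det_diag (big_enum_val (fun K => 'X + wgt K)).
  by apply: eq_bigr => c _; rewrite mxE.
have detD : \det D = \prod_(K in P) ('X + wgt K) ^+ #|K|.
  rewrite det_diag; under eq_bigr do rewrite mxE.
  rewrite -(big_enum_val (fun x => 'X + wgt (pblock P x))) /=.
  rewrite (eq_bigl (mem [set: G])) => [|x]; last by rewrite !inE.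
  rewrite (set_partition_big _ P_part) /=; apply: eq_bigr => K KP.
  rewrite -prodr_const; apply: eq_bigr => x xK.
  by rewrite (def_pblock P_triv KP xK).
(* Distinct cliques are disjoint, so [V *m inc] is diagonal. Its entry at a clique with m + 1
   vertices is (m + 1) m^2, and X + m^2 - (m + 1) m^2 = X - m^3. *)
have detEVU : \det (E - V *m inc) = \prod_(K in P) ('X - (#|K|.-1 ^ 3)%:R).
  have -> : E - V *m inc = diag_mx (\row_c ('X - (#|clq c|.-1 ^ 3)%:R)).
    apply/matrixP=> c d; rewrite !mxE.
    under eq_bigr do rewrite !mxE mulr_natr.
    rewrite -(big_enum_val
      (fun x => wgt (clq c) *+ (x \in clq c) *+ (x \in clq d))) /=.
    have [<- | cNd] := eqVneq c d; last first.
      rewrite !mulr0n big1 ?subrr // => x _.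
      have [/blockE xc | _] := boolP (x \in clq c); last by rewrite mul0rn.
      have [/blockE xd | //] := boolP (x \in clq d).
      by case/eqP: cNd; apply: enum_val_inj; rewrite -[LHS]xc.
    rewrite (bigID (mem (clq c))) /= [X in _ - (_ + X)]big1 => [|x /negPf->] //.
    rewrite (eq_bigr (fun=> wgt (clq c))) => [|x ->] //.
    rewrite sumr_const !mulr1n addr0 /wgt.
    have /ltnW/ltnW := clique_gt2 (enum_valP c); rewrite -/(clq c).
    case: #|clq c| => // m _ /=.
    rewrite -addrA; congr (_ + _).
    by rewrite mulrS opprD addrA subrr sub0r -mulrnA -expnSr.
  rewrite det_diag (big_enum_val (fun K : {set G} => 'X - (#|K|.-1 ^ 3)%:R)).
  by apply: eq_bigr => c _; rewrite mxE.
have E_neq0 : \det E != 0.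
  rewrite detE; apply/prodf_neq0 => K _.
  by rewrite -size_poly_eq0 /wgt -polyC_natr size_XaddC.
apply: (mulIf E_neq0); rewrite /char_poly char_mxE (det_sub_mulmx V DU).
rewrite detE detD detEVU -!big_split /=; apply: eq_bigr => K KP.
rewrite /wgt; have /ltnW/ltnW := clique_gt2 KP; case: #|K| => //= m _.
by rewrite exprS -mulrA mulrC.
Qed.

End DisjointCliques.

(** * Spectrum and energy contributed by cliques of equal order *)

Lemma spectrum_perm n (A : 'M[algC]_n) s :
  char_poly A = \prod_(x <- s) ('X - x%:P) -> perm_eq (spectrum A) s.
Proof.
move=> As; apply: prod_XsubC_eq; rewrite -As /spectrum.
case: closed_field_poly_normal => r /= ->.
by rewrite (monicP (char_poly_monic A)) scale1r.
Qed.

(** The share of the spectrum due to [l] cliques with [m + 1] vertices each, as pairs of value and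
    multiplicity for [tally_seq]. *)
Definition clique_tally (m l : nat) : seq (algC * nat) :=
  [:: (- m%:R ^+ 2, (l * m)%N); (m%:R ^+ 3, l)].

Lemma prod_clique_tally m l :
  \prod_(x <- tally_seq (clique_tally m l)) ('X - x%:P) =
  (('X + (m ^ 2)%:R) ^+ m * ('X - (m ^ 3)%:R)) ^+ l :> {poly algC}.
Proof.
rewrite /tally_seq /= cats0 big_cat !big_nseq /= !iter_mulr_1.
by rewrite exprMn -exprM mulnC polyCN opprK -!natrX !polyC_natr.
Qed.

Lemma sum_norm_clique_tally m l :
  \sum_(x <- tally_seq (clique_tally m l)) `|x| = 2 * l%:R * m%:R ^+ 3.
Proof.
rewrite /tally_seq /= cats0 big_cat !big_nseq /= !iter_addr_0.
rewrite normrN !normrX normr_nat.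
rewrite -[X in X + _]mulr_natr -[X in _ + X]mulr_natr natrM.
ring.
Qed.

(** * Disjoint cliques of at most two orders *)

Section TwoCliqueSizes.

Variables (G : sgraph) (P : {set {set G}}) (m1 m2 : nat).
Hypothesis P_part : partition P [set: G].
Hypothesis adjE : forall x y : G, adj x y = (x != y) && (y \in pblock P x).
Hypotheses (m1_gt1 : (1 < m1)%N) (m2_gt1 : (1 < m2)%N).
Hypothesis size_clique :
  {in P, forall K : {set G}, (#|K| == m1.+1) || (#|K| == m2.+1)}.

Let l1 := #|[set K in P | #|K| == m1.+1]|.
(** The condition is the negation of the one in [l1], so that every clique is counted once even when
    [m1 = m2], as in case (b). *)
Let l2 := #|[set K in P | #|K| != m1.+1]|.

Lemma msn_spectrum_cliques :
  perm_eq (msn_spectrum G) (tally_seq (clique_tally m1 l1 ++ clique_tally m2 l2)).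
Proof.
apply: spectrum_perm; rewrite (char_poly_cliques P_part adjE); last first.
  by move=> K /size_clique/orP[]/eqP->.
rewrite /tally_seq map_cat flatten_cat big_cat -!/(tally_seq _) /=.
rewrite !prod_clique_tally (bigID (fun K : {set G} => #|K| == m1.+1)) /=.
rewrite /l1 /l2 -!prodr_const; congr (_ * _).
  by apply: eq_big => K; rewrite ?inE // => /andP[_ /eqP->].
by apply: eq_big => K; rewrite ?inE // => /andP[/size_clique/orP[->|/eqP->]].
Qed.

Lemma msn_energy_cliques :
  msn_energy G = 2 * l1%:R * m1%:R ^+ 3 + 2 * l2%:R * m2%:R ^+ 3.
Proof.
rewrite /msn_energy (perm_big _ msn_spectrum_cliques).
rewrite /tally_seq map_cat flatten_cat big_cat -!/(tally_seq _) /=.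
by rewrite !sum_norm_clique_tally.
Qed.

Lemma card_two_cliques : #|G| = (l1 * m1.+1 + l2 * m2.+1)%N.
Proof.
rewrite -cardsT (card_partition P_part).
rewrite (bigID (fun K : {set G} => #|K| == m1.+1)) /= /l1 /l2 -!sum_nat_const.
congr (_ + _)%N; first by apply: eq_big => K; rewrite ?inE // => /andP[_ /eqP->].
by apply: eq_big => K; rewrite ?inE // => /andP[/size_clique/orP[->|/eqP->]].
Qed.

End TwoCliqueSizes.

(** Lagrange's theorem in the additive group of [V]. *)
Lemma card_zmod_closed (V : finZmodType) (A : {set V}) :
  zmod_closed A -> (#|A| %| #|V|)%N.
Proof.
move=> clA; have gA : group_set A.
  apply/group_setP; split; first exact: clA.1.
  move=> x y xA yA; rewrite -[y]opprK; apply: clA.2 => //.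
  by rewrite -sub0r; apply: clA.2 => //; exact: clA.1.
by have := cardSg (subsetT (Group gA)); rewrite cardsT.
Qed.

(** * Centralizers in a ring of prime power order *)

Section Centralizers.

Variable R : finNzRingType.
Implicit Types (A B : {set R}) (x y z : R).

(** Subsets are allowed so that Z(R), C(x), C(x) & C(y) and Z(C(x)) are all centralizers. *)
Definition centralizer A : {set R} := [set y | [forall x in A, x * y == y * x]].

Lemma centralizerP A y :
  reflect {in A, forall x, x * y = y * x} (y \in centralizer A).
Proof. by rewrite inE; apply: (iffP eqfun_inP). Qed.

Lemma centralizer1P x y : reflect (x * y = y * x) (y \in centralizer [set x]).
Proof.
apply: (iffP (centralizerP _ _)) => [-> //|xy z /set1P->//]; exact: set11.
Qed.

Lemma centralizerS A B : A \subset B -> centralizer B \subset centralizer A.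
Proof.
move/subsetP=> sAB; apply/subsetP=> y /centralizerP yB.
by apply/centralizerP=> x /sAB/yB.
Qed.

Lemma centralizerT : centralizer setT = center R.
Proof.
apply/setP=> y; rewrite !inE; apply: eq_forallb => x.
by rewrite inE /= eq_sym.
Qed.

Lemma center_sub_centralizer A : center R \subset centralizer A.
Proof. by rewrite -centralizerT; apply/centralizerS/subsetT. Qed.

Lemma centralizer_zmod_closed A : zmod_closed (centralizer A).
Proof.
split=> [|y z /centralizerP yA /centralizerP zA]; apply/centralizerP=> x xA.
  by rewrite mulr0 mul0r.
by rewrite mulrBr mulrBl yA ?zA.
Qed.

Section PrimePowerOrder.

Variables (p n : nat).
Hypotheses (p_prime : prime p) (R_card : #|R| = (p ^ n)%N).

Lemma card_centralizer A : exists2 d, (d <= n)%N & #|centralizer A| = (p ^ d)%N.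
Proof.
have := card_zmod_closed (centralizer_zmod_closed A); rewrite R_card.
by move/(dvdn_pfactor _ _ p_prime).
Qed.

Lemma logn_card_centralizer A : #|centralizer A| = (p ^ logn p #|centralizer A|)%N.
Proof. by have [d _ ->] := card_centralizer A; rewrite pfactorK. Qed.

(** Orders of centralizers are powers of [p], so each strict inclusion raises the exponent by at
    least 1. This bounds the length of chains. *)
Lemma logn_centralizer_proper A B : centralizer A \proper centralizer B ->
  (logn p #|centralizer A| < logn p #|centralizer B|)%N.
Proof.
move/proper_card=> ltAB.
by rewrite -(ltn_exp2l _ _ (prime_gt1 p_prime)) -!logn_card_centralizer.
Qed.

Lemma logn_center_lt x : x \notin center R ->
  (logn p #|center R| < logn p #|centralizer [set x]|)%N.
Proof.
rewrite -centralizerT => xNZ; apply: logn_centralizer_proper.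
apply/properP; split; first exact/centralizerS/subsetT.
by exists x => //; apply/centralizer1P.
Qed.

Lemma logn_centralizer1_lt x : x \notin center R ->
  (logn p #|centralizer [set x]| < n)%N.
Proof.
rewrite -centralizerT => xNZ.
suff : (#|centralizer [set x]| < #|R|)%N.
  move=> ltCR; rewrite -(ltn_exp2l _ _ (prime_gt1 p_prime)).
  by rewrite -logn_card_centralizer -R_card.
rewrite -cardsT; apply: proper_card; apply/properP; split; first exact: subsetT.
have /centralizerP xNZ' := xNZ.
have [y] : exists y, x * y != y * x.
  apply/existsP; apply: contraNT xNZ; rewrite negb_exists => /forallP xZ.
  by apply/centralizerP => y _; apply/esym/eqP; have := xZ y; rewrite negbK.
move=> xy; exists y; first by rewrite inE.
by apply: contra xy => /centralizer1P->.
Qed.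

(* Otherwise, for [y] in C(x) and not in the center of C(x),
   Z(R) < Z(C(x)) < C(x) & C(y) < C(x) < R is a strict chain of subgroups.
   As [x] is in C(x), Z(C(x)) is the centralizer of C(x) in R. *)
Lemma centralizer1_commutative x : x \notin center R ->
  (n <= (logn p #|center R|).+3)%N ->
  {in centralizer [set x] &, commutative *%R}.
Proof.
move=> xNZ n_le; set C := centralizer [set x].
suff sC : C \subset centralizer C.
  by move=> y z yC zC; apply: (centralizerP _ _ (subsetP sC z zC)).
have xC : x \in C by apply/centralizer1P.
apply/subsetP=> y yC; apply: contraT => yNZ; exfalso.
have sxy : [set x; y] \subset C by rewrite subUset !sub1set xC.
(* The next three strict inclusions are witnessed in turn by [x], by [y], and by an element of [C]
   that does not commute with [y]. *)
have ltZ : centralizer setT \proper centralizer C.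
  apply/properP; split; first exact/centralizerS/subsetT.
  exists x; last by rewrite centralizerT.
  by apply/centralizerP=> z /centralizer1P.
have ltCx : centralizer C \proper centralizer [set x; y].
  apply/properP; split; first exact: centralizerS.
  exists y => //; apply/centralizerP=> z /set2P[]-> //; exact/centralizer1P.
have ltxy : centralizer [set x; y] \proper C.
  apply/properP; split; first by apply: centralizerS; rewrite sub1set set21.
  have [z zC zy] : exists2 z, z \in C & z * y != y * z.
    apply/exists_inP; apply: contraNT yNZ; rewrite negb_exists => /forallP yZ.
    apply/centralizerP=> z zC; apply/eqP.
    by have := yZ z; rewrite zC /= negbK.
  exists z => //; apply: contra zy => /centralizerP zxy.
  by rewrite -zxy ?set22.
(* Four strict steps between the exponent k of |Z(R)| and [n] give k + 4 <= n, against n <= k +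
   3. *)
move/logn_centralizer_proper: ltZ; move/logn_centralizer_proper: ltCx.
move/logn_centralizer_proper: ltxy; have := logn_centralizer1_lt xNZ.
rewrite centralizerT -/C; lia.
Qed.

End PrimePowerOrder.
End Centralizers.

(** * The commuting graph when all C(x) are commutative *)

Section CommutingCliques.

Variable R : finNzRingType.
Hypothesis centralizer_comm : forall x : R, x \notin center R ->
  {in centralizer [set x] &, commutative *%R}.

Let V : finType := commuting_graph R.
Let commutes (x y : V) : bool := val x * val y == val y * val x.

Definition commuting_cliques : {set {set commuting_graph R}} :=
  equivalence_partition commutes [set: V].

(** Transitivity: two elements that commute with a non-central x both lie in C(x), which is
    commutative. *)
Lemma commutes_equivalence : {in [set: V] & &, equivalence_rel commutes}.
Proof.
move=> x y z _ _ _; split=> [|/eqP xy]; first exact: eqxx.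
have ZNy := valP y; have ZNx := valP x.
apply/eqP/eqP=> [xz | yz].
  by apply: (centralizer_comm ZNx); apply/centralizer1P.
by apply: (centralizer_comm ZNy); apply/centralizer1P.
Qed.

Lemma commuting_cliques_partition : partition commuting_cliques [set: V].
Proof. exact: equivalence_partitionP commutes_equivalence. Qed.

Lemma mem_commuting_clique (x y : V) :
  (y \in pblock commuting_cliques x) = (val x * val y == val y * val x).
Proof. by rewrite (pblock_equivalence_partition commutes_equivalence) ?inE. Qed.

Lemma commuting_adj_cliques (x y : commuting_graph R) :
  adj x y = (x != y) && (y \in pblock commuting_cliques x).
Proof. by rewrite mem_commuting_clique. Qed.

(** The injection [val] maps the clique of x onto C(x) \ Z(R), and Z(R) is contained in C(x). *)
Lemma card_commuting_clique (K : {set V}) : K \in commuting_cliques ->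
  exists2 x, x \notin center R
           & (#|K| = #|centralizer [set x]| - #|center R|)%N.
Proof.
move=> KP.
have /set0Pn[x xK] := partition_neq0 commuting_cliques_partition KP.
exists (val x); first exact: valP x.
have <- : pblock commuting_cliques x = K.
  exact: def_pblock (partition_trivIset commuting_cliques_partition) KP xK.
have <- : #|centralizer [set val x] :\: center R| =
    (#|centralizer [set val x]| - #|center R|)%N.
  by rewrite cardsD (setIidPr (center_sub_centralizer _)).
rewrite -(card_imset _ val_inj).
apply: eq_card => y; rewrite in_setD.
apply/imsetP/andP=> [[u] | [ZNy /centralizer1P/eqP yC]].
  rewrite mem_commuting_clique => /eqP uC ->; split; first exact: valP u.
  exact/centralizer1P.
by exists (Sub y ZNy : V); rewrite // mem_commuting_clique.
Qed.

End CommutingCliques.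

(** * Clique orders when R and Z(R) have prime power orders *)

Section PrimePowerCliques.

Variables (p n k : nat) (R : finNzRingType).
Hypotheses (p_prime : prime p) (R_card : #|R| = (p ^ n)%N).
Hypotheses (Z_card : #|center R| = (p ^ k)%N) (n_le : (n <= k.+3)%N).

Lemma centralizer1_comm x : x \notin center R ->
  {in centralizer [set x] &, commutative *%R}.
Proof.
move=> xNZ; apply: (centralizer1_commutative p_prime R_card xNZ).
by rewrite Z_card pfactorK.
Qed.

Lemma card_prime_power_clique (K : {set commuting_graph R}) :
  K \in commuting_cliques R ->
  exists2 d, (k < d < n)%N & #|K| = (p ^ d - p ^ k)%N.
Proof.
case/(card_commuting_clique centralizer1_comm) => x xNZ ->.
exists (logn p #|centralizer [set x]|); last first.
  by rewrite Z_card -(logn_card_centralizer p_prime R_card).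
rewrite (logn_centralizer1_lt p_prime R_card xNZ) andbT.
by have := logn_center_lt p_prime R_card xNZ; rewrite Z_card pfactorK.
Qed.

Lemma card_commuting_graph : #|commuting_graph R| = (p ^ n - p ^ k)%N.
Proof.
have <- : (#|R| - #|center R| = p ^ n - p ^ k)%N by rewrite R_card Z_card.
by rewrite card_sig -(cardC (center R)) addKn; apply: eq_card.
Qed.

End PrimePowerCliques.

(** From p^d >= 2 p^k the difference is at least p^k >= 4. Hence all cliques have more than two
    vertices, and the truncated subtractions of the multiplicities are exact. *)
Lemma expn_sub_gt2 p k d : prime p -> (1 < k < d)%N -> (2 < p ^ d - p ^ k)%N.
Proof.
move=> /prime_gt1 p_gt1 /andP[k_gt1 lt_kd].
have : (2 * p ^ k <= p ^ d)%N.
  apply: leq_trans (leq_pexp2l (ltnW p_gt1) lt_kd).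
  by rewrite expnS leq_mul2r p_gt1 orbT.
have : (p ^ 2 <= p ^ k)%N by rewrite leq_pexp2l // ltnW.
have : (2 ^ 2 <= p ^ 2)%N by rewrite leq_exp2r.
lia.
Qed.

Lemma natr_expn_sub p k d : prime p -> (1 < k < d)%N ->
  (p ^ d - p ^ k - 1)%:R = p%:R ^+ d - p%:R ^+ k - 1 :> algC.
Proof.
move=> p_prime kd; have gt2 := expn_sub_gt2 p_prime kd.
rewrite natrB; last by apply: ltnW; apply: ltnW.
by rewrite natrB ?natrX // ltnW // -subn_gt0 ltnW // ltnW.
Qed.

Theorem theorem3p3 (p : nat) (R : finNzRingType)
    (p_prime : prime p)
    (R_noncomm : ~ commutative (@GRing.mul R))
    (R_card : #|R| = (p ^ 5)%N)
    (Z_not_field : ~ is_field (center R)) :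
  (#|center R| = (p ^ 2)%N ->
     (perm_eq (msn_spectrum (commuting_graph R))
        (tally_seq
          [:: (- (p%:R ^+ 3 - p%:R ^+ 2 - 1) ^+ 2,
               ((p ^ 2 + p + 1) * (p ^ 3 - p ^ 2 - 1))%N);
              ((p%:R ^+ 3 - p%:R ^+ 2 - 1) ^+ 3, (p ^ 2 + p + 1)%N)])
      /\ msn_energy (commuting_graph R)
         = 2 * (p%:R ^+ 2 + p%:R + 1) * (p%:R ^+ 3 - p%:R ^+ 2 - 1) ^+ 3)
     \/
     (exists l1 l2 : nat,
        [/\ (l1 + l2 * (p + 1) = p ^ 2 + p + 1)%N,
            perm_eq (msn_spectrum (commuting_graph R))
              (tally_seq
                [:: (- (p%:R ^+ 3 - p%:R ^+ 2 - 1) ^+ 2,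
                     (l1 * (p ^ 3 - p ^ 2 - 1))%N);
                    ((p%:R ^+ 3 - p%:R ^+ 2 - 1) ^+ 3, l1);
                    (- (p%:R ^+ 4 - p%:R ^+ 2 - 1) ^+ 2,
                     (l2 * (p ^ 4 - p ^ 2 - 1))%N);
                    ((p%:R ^+ 4 - p%:R ^+ 2 - 1) ^+ 3, l2)])
          & msn_energy (commuting_graph R)
            = 2 * l1%:R * (p%:R ^+ 3 - p%:R ^+ 2 - 1) ^+ 3
              + 2 * l2%:R * (p%:R ^+ 4 - p%:R ^+ 2 - 1) ^+ 3]))
  /\
  (#|center R| = (p ^ 3)%N ->
     perm_eq (msn_spectrum (commuting_graph R))
       (tally_seq
         [:: (- (p%:R ^+ 4 - p%:R ^+ 3 - 1) ^+ 2,
              ((p + 1) * (p ^ 4 - p ^ 3 - 1))%N);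
             ((p%:R ^+ 4 - p%:R ^+ 3 - 1) ^+ 3, (p + 1)%N)])
     /\ msn_energy (commuting_graph R)
        = 2 * (p%:R + 1) * (p%:R ^+ 4 - p%:R ^+ 3 - 1) ^+ 3).

Proof.
have sub1K d k : (1 < k < d)%N -> (p ^ d - p ^ k - 1).+1 = (p ^ d - p ^ k)%N.
  by move/(expn_sub_gt2 p_prime); lia.
have sub1_gt1 d k : (1 < k < d)%N -> (1 < p ^ d - p ^ k - 1)%N.
  by move/(expn_sub_gt2 p_prime); lia.
split=> Z_card.
  right.
  (* Here [isT] proves 5 <= 2 + 3: the chain bound holds with equality. *)
  have comm := centralizer1_comm p_prime R_card Z_card isT.
  have P_part := commuting_cliques_partition comm.
  have adjE := commuting_adj_cliques comm.
  pose m1 := (p ^ 3 - p ^ 2 - 1)%N; pose m2 := (p ^ 4 - p ^ 2 - 1)%N.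
  have sizeP : {in commuting_cliques R, forall K : {set commuting_graph R},
      (#|K| == m1.+1) || (#|K| == m2.+1)}.
    move=> K /(card_prime_power_clique p_prime R_card Z_card isT)[d].
    rewrite /m1 /m2 !sub1K //.
    (* The bounds 2 < d < 5 leave d = 3 and d = 4. *)
    by case: d => [|[|[|[|[|d]]]]] // _ ->; rewrite eqxx ?orbT.
  have m1_gt1 : (1 < m1)%N by exact: sub1_gt1.
  have m2_gt1 : (1 < m2)%N by exact: sub1_gt1.
  have := card_two_cliques P_part sizeP.
  have := msn_energy_cliques P_part adjE m1_gt1 m2_gt1 sizeP.
  have := msn_spectrum_cliques P_part adjE m1_gt1 m2_gt1 sizeP.
  set l1 := #|_|; set l2 := #|_| => spec energy card_eq.
  exists l1, l2; split.
  - move: card_eq; rewrite (card_commuting_graph R_card Z_card) /m1 /m2 !sub1K //.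
    (* Writing p = r + 1 removes the truncated subtractions. With q = p^2 (p - 1), the three
       differences p^5 - p^2, p^3 - p^2 and p^4 - p^2 are q (p^2 + p + 1), q and q (p + 1);
       cancelling q gives the relation. *)
    have := prime_gt1 p_prime; case: (p) => // r r_gt0.
    have -> : (r.+1 ^ 5 = r.+1 ^ 2 * r * (r.+1 ^ 2 + r.+1 + 1) + r.+1 ^ 2)%N by ring.
    have -> : (r.+1 ^ 3 = r.+1 ^ 2 * r + r.+1 ^ 2)%N by ring.
    have -> : (r.+1 ^ 4 = r.+1 ^ 2 * r * (r.+1 + 1) + r.+1 ^ 2)%N by ring.
    rewrite !addnK => card_eq.
    have q_gt0 : (0 < r.+1 ^ 2 * r)%N by rewrite muln_gt0 expn_gt0.
    by apply/eqP; rewrite -(eqn_pmul2l q_gt0) card_eq; apply/eqP; ring.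
  - by rewrite -!natr_expn_sub.
  - by rewrite -!natr_expn_sub.
have comm := centralizer1_comm p_prime R_card Z_card isT.
have P_part := commuting_cliques_partition comm.
have adjE := commuting_adj_cliques comm.
pose m := (p ^ 4 - p ^ 3 - 1)%N.
have size_m (K : {set commuting_graph R}) : K \in commuting_cliques R -> #|K| = m.+1.
  move=> /(card_prime_power_clique p_prime R_card Z_card isT)[d].
  rewrite /m !sub1K //.
  by case: d => [|[|[|[|[|d]]]]].
(* Only d = 4 is possible, so the results for two orders are applied with both equal to [m.+1]; the
   second count is then 0. *)
have sizeP : {in commuting_cliques R, forall K : {set commuting_graph R},
    (#|K| == m.+1) || (#|K| == m.+1)} by move=> K /size_m->; rewrite eqxx.
have m_gt1 : (1 < m)%N by exact: sub1_gt1.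
have := card_two_cliques P_part sizeP.
have := msn_energy_cliques P_part adjE m_gt1 m_gt1 sizeP.
have := msn_spectrum_cliques P_part adjE m_gt1 m_gt1 sizeP.
set l := #|_|; set l2 := #|_|.
have -> : l2 = 0%N.
  apply: eq_card0 => K; rewrite inE; apply/andP=> -[/size_m->].
  by rewrite eqxx.
move=> spec energy card_eq.
have l_eq : l = (p + 1)%N.
  move: card_eq; rewrite (card_commuting_graph R_card Z_card) /m !sub1K //.
  (* Both p^5 - p^3 and p^4 - p^3 have the factor p^3 (p - 1), and their quotient is p + 1. *)
  have := prime_gt1 p_prime; case: (p) => // r r_gt0.
  have -> : (r.+1 ^ 5 = r.+1 ^ 3 * r * (r.+1 + 1) + r.+1 ^ 3)%N by ring.
  have -> : (r.+1 ^ 4 = r.+1 ^ 3 * r + r.+1 ^ 3)%N by ring.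
  rewrite !addnK mul0n addn0 mulnC => /eqP.
  by rewrite eqn_pmul2r ?muln_gt0 ?expn_gt0 // => /eqP.
rewrite l_eq in spec energy; split.
  by rewrite -!natr_expn_sub.
by rewrite -!natr_expn_sub // energy natrD; ring.
Qed.
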